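(* Let $E$ be a finite simple (directed) graph, let $G(E)$ be the graph inverse semigroup of $E$, let $L(G(E))$ be the lattice of congruences on $G(E)$, and let $\mathcal{A}\subseteq L(G(E))$. Then $\mathcal{A}$ generates $L(G(E))$ if and only if $\mathcal{A}$ contains all the congruences of the following types: (i) $(\{v\},\varnothing,\varnothing)$, such that $v\in E^0$ and $|\mathbf{s}^{-1}(v)|=0$; (ii) $(H,\{v\},\varnothing)$, such that $v\in E^0$, $|\mathbf{s}^{-1}(v)|>0$, and $H$ is a minimal (with respect to containment) hereditary subset of $E^0$ satisfying $|\mathbf{s}_{E\setminus H}^{-1}(v)|=1$.
   Context: A (directed) graph $E=(E^0,E^1,\mathbf{s},\mathbf{r})$ consists of a set $E^0$ of vertices, a set $E^1$ of edges, and functions $\mathbf{s},\mathbf{r}:E^1\to E^0$ (source and range). It is finite if $E^0$ and $E^1$ are finite. A path is a finite sequence $p=e_1\cdots e_n$ of edges with $\mathbf{r}(e_i)=\mathbf{s}(e_{i+1})$; vertices are paths of length $0$. A cycle is a path $e_1\cdots e_n$ with $n\ge1$, equal source and range, and $\mathbf{s}(e_i)\ne\mathbf{s}(e_j)$ for $i\ne j$. A graph is simple if it has no cycles and no two distinct edges with the same source and the same range. For $u,v\in E^0$ write $u\ge v$ if there is a path (possibly of length $0$) from $u$ to $v$. A set $H\subseteq E^0$ is hereditary if $u\in H$ and $u\ge v$ imply $v\in H$. For $H\subseteq E^0$, $E\setminus H$ is the graph with vertex set $E^0\setminus H$ and edge set $\{e\in E^1\mid\mathbf{s}(e)\notin H\text{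 and }\mathbf{r}(e)\notin H\}$, with source and range maps $\mathbf{s}_{E\setminus H},\mathbf{r}_{E\setminus H}$ the restrictions of $\mathbf{s},\mathbf{r}$. The graph inverse semigroup $G(E)$ is the semigroup with zero generated by $E^0\cup E^1\cup\{e^{-1}\mid e\in E^1\}$ subject to, for all $u,v\in E^0$ and $e,f\in E^1$: $vu=\delta_{v,u}v$; $\mathbf{s}(e)e=e\mathbf{r}(e)=e$; $\mathbf{r}(e)e^{-1}=e^{-1}\mathbf{s}(e)=e^{-1}$; $e^{-1}f=\delta_{e,f}\mathbf{r}(e)$ (here $\delta$ is the Kronecker delta, so $\delta_{x,y}z$ means $z$ if $x=y$ and the zero element otherwise). A congruence on a semigroup $S$ is an equivalence relation $\rho$ on $S$ such that $(x,y)\in\rho$ implies $(zx,zy),(xz,yz)\in\rho$ for all $z\in S$. $L(S)$ is the lattice of all congruences on $S$ ordered by containment. For an acyclic graph $E$, a Wang triple $(H,W,\varnothing)$ on $E$ consists of a hereditary set $H\subseteq E^0$ and a set $W\subseteq\{v\in E^0\setminus H\mid|\mathbf{s}_{E\setminus H}^{-1}(v)|=1\}$. (The third component, a function on the cycles of $E$, is vacuous for acyclic $E$.) The triple $(H,W,\varnothing)$ is identified with the congruence on $G(E)$ generated by $(H\times\{0\})\cup\{(w,ee^{-1})\mid w\in W,\ \mathbf{s}(e)=w,\ \mathbf{r}(e)\notin H\}$. By a known result of Luo and Wang, this identification is an order-isomorphism from the set of Wang triples on $E$, ordered by $(H_1,W_1,\varnothing)\le(H_2,W_2,\varnothing)$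 iff $H_1\subseteq H_2$ and $W_1\setminus H_2\subseteq W_2$, onto $L(G(E))$. A subset $X$ of a lattice $L$ generates $L$ if every element of $L$ is a join of finitely many elements of $X$; by convention the diagonal congruence is the join of the empty set of congruences. *)

(* Defs.v *)
From HB Require Import structures.
From mathcomp Require Import all_boot all_order.
From mathcomp Require Import boolp classical_sets.

Set Implicit Arguments.
Unset Strict Implicit.
Unset Printing Implicit Defensive.

Import Order.TTheory.

Local Open Scope classical_set_scope.

Record digraph := Digraph {
  vertex : finType;
  edge : finType;
  src : edge -> vertex;
  rng : edge -> vertex
}.

Section Graph.
Variable E : digraph.
Implicit Types (u v : vertex E) (p : seq (edge E)) (H : {set vertex E}).

(* The empty sequence stands for the path of length 0 at each vertex. *)
Fixpoint is_path u p v : bool :=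
  if p is e :: p' then (src e == u) && is_path (rng e) p' v else u == v.

Definition is_cycle p : Prop :=
  [/\ p != [::], exists v, is_path v p v & uniq (map (@src E) p)].

Definition simple_digraph : Prop :=
  (forall p, ~ is_cycle p) /\
  (forall e f : edge E, src e = src f -> rng e = rng f -> e = f).

Definition reaches u v : Prop := exists p, is_path u p v.

Definition hereditary H : Prop :=
  forall u v, u \in H -> reaches u v -> v \in H.

(* The edge set of E \ H. *)
Definition edges_off H : {set edge E} :=
  [set e : edge E | (src e \notin H) && (rng e \notin H)]%SET.

(* The preimage of v under the source map of E \ H. *)
Definition out_edges_off H v : {set edge E} :=
  [set e in edges_off H | src e == v]%SET.

Definition out_edges v : {set edge E} := [set e | src e == v]%SET.

End Graph.

Section Congruence.
Variable S : semigroupType.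
Implicit Types (r : set (S * S)).

Definition is_congruence r : Prop :=
  [/\ forall x, r (x, x),
      forall x y, r (x, y) -> r (y, x),
      forall x y z, r (x, y) -> r (y, z) -> r (x, z) &
      forall x y z, r (x, y) -> r (z * x, z * y)%g /\ r (x * z, y * z)%g].

Record congruence := Congruence {
  cong_rel :> set (S * S);
  _ : `[< is_congruence cong_rel >]
}.

HB.instance Definition _ := [isSub for cong_rel].
HB.instance Definition _ := [Choice of congruence by <:].

Lemma congruenceP (c : congruence) : is_congruence c.
Proof. by apply/asboolP; apply: (valP c). Qed.

Definition mk_congruence r (hr : is_congruence r) : congruence :=
  Congruence (asboolT hr).

Lemma smallest_is_congruence r : is_congruence (smallest is_congruence r).
Proof.
split=> [x|x y h|x y z h k|x y z h].
- by move=> M [[refl _ _ _] _]; apply: refl.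
- by move=> M hM; have [[_ sym _ _] _] := hM; apply: sym (h M hM).
- by move=> M hM; have [[_ _ trans _] _] := hM; apply: trans (h M hM) (k M hM).
- by split=> M hM; have [[_ _ _ comp] _] := hM; have [] := comp _ _ z (h M hM).
Qed.

Definition cong_gen r : congruence := mk_congruence (smallest_is_congruence r).

Lemma diagonal_is_congruence : is_congruence [set p | p.1 = p.2].
Proof. by split=> //= [x y z -> ->|x y z ->]. Qed.

Lemma total_is_congruence : is_congruence setT.
Proof. by split. Qed.

Lemma setI_is_congruence (c d : congruence) : is_congruence (c `&` d).
Proof.
have [cr cs ct cc] := congruenceP c; have [dr ds dt dc] := congruenceP d.
split=> [x|x y [? ?]|x y z [h1 h2] [k1 k2]|x y z [h k]].
- by split; [apply: cr | apply: dr].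
- by split; [apply: cs | apply: ds].
- by split; [apply: ct h1 k1 | apply: dt h2 k2].
- by have [? ?] := cc _ _ z h; have [? ?] := dc _ _ z k; split; split.
Qed.

Definition cong_meet (c d : congruence) : congruence :=
  mk_congruence (setI_is_congruence c d).
Definition cong_join (c d : congruence) : congruence := cong_gen (c `|` d).

End Congruence.

Fact cong_display : Order.disp_t. Proof. by []. Qed.

Section CongruenceLattice.
Variable S : semigroupType.
Implicit Types c d b : congruence S.

HB.instance Definition _ :=
  [SubChoice_isSubPOrder of congruence S by <: with cong_display].

Lemma le_congP c d : reflect (cong_rel c `<=` cong_rel d) (c <= d)%O.
Proof. exact: asboolP. Qed.

Fact cong_lexI c d b : (c <= cong_meet d b)%O = (c <= d)%O && (c <= b)%O.
Proof.
apply/le_congP/andP => [h|[/le_congP h /le_congP k]].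
  by split; apply/le_congP => p /h [].
by move=> p cp; split; [apply: h | apply: k].
Qed.

Fact cong_leUx c d b : (cong_join c d <= b)%O = (c <= b)%O && (d <= b)%O.
Proof.
apply/le_congP/andP => [h|[/le_congP h /le_congP k]].
  by split; apply/le_congP => p q; apply: h; apply: sub_gen_smallest;
    [left | right].
apply: smallest_sub; first exact: congruenceP.
by move=> p [/h|/k].
Qed.

HB.instance Definition _ :=
  Order.POrder_MeetJoin_isLattice.Build cong_display (congruence S)
    cong_lexI cong_leUx.

Fact cong_le0x c : (mk_congruence (@diagonal_is_congruence S) <= c)%O.
Proof.
have [refl _ _ _] := congruenceP c.
by apply/le_congP => -[x y] /= ->; apply: refl.
Qed.

HB.instance Definition _ :=
  Order.hasBottom.Build cong_display (congruence S) cong_le0x.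

Fact cong_lex1 c : (c <= mk_congruence (@total_is_congruence S))%O.
Proof. exact/le_congP. Qed.

HB.instance Definition _ :=
  Order.hasTop.Build cong_display (congruence S) cong_lex1.

End CongruenceLattice.

(* The empty join is \bot, which in L(S) is the diagonal congruence. *)
Definition join_generates (d : Order.disp_t) (L : bLatticeType d) (X : set L) :
    Prop :=
  forall a : L, exists2 s : seq L,
    (forall x, x \in s -> X x) & a = (\join_(x <- s) x)%O.

(* The graph inverse semigroup G(E) is given by its presentation: terms over the
   generators and a zero, modulo the least congruence that contains the
   semigroup-with-zero laws and the defining relations. *)

Section GraphInverseSemigroup.
Variable E : digraph.

Inductive gterm : Type :=
  | TZero
  | TVert of vertex E
  | TEdge of edge E
  | TInv of edge E
  | TMul of gterm & gterm.

HB.instance Definition _ := gen_eqMixin gterm.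
HB.instance Definition _ := gen_choiceMixin gterm.

Inductive geq : gterm -> gterm -> Prop :=
  | geq_refl x : geq x x
  | geq_sym x y : geq x y -> geq y x
  | geq_trans x y z : geq x y -> geq y z -> geq x z
  | geq_mul x x' y y' : geq x x' -> geq y y' -> geq (TMul x y) (TMul x' y')
  | geq_assoc x y z : geq (TMul x (TMul y z)) (TMul (TMul x y) z)
  | geq_mul0t x : geq (TMul TZero x) TZero
  | geq_mult0 x : geq (TMul x TZero) TZero
  | geq_vert u v :
      geq (TMul (TVert v) (TVert u)) (if v == u then TVert v else TZero)
  | geq_src_edge e : geq (TMul (TVert (src e)) (TEdge e)) (TEdge e)
  | geq_edge_rng e : geq (TMul (TEdge e) (TVert (rng e))) (TEdge e)
  | geq_rng_inv e : geq (TMul (TVert (rng e)) (TInv e)) (TInv e)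
  | geq_inv_src e : geq (TMul (TInv e) (TVert (src e))) (TInv e)
  | geq_inv_edge e f :
      geq (TMul (TInv e) (TEdge f)) (if e == f then TVert (rng e) else TZero).

Definition geqb (x y : gterm) : bool := `[< geq x y >].

Fact geqb_refl : reflexive geqb.
Proof. by move=> x; apply/asboolP; apply: geq_refl. Qed.

Fact geqb_sym : symmetric geqb.
Proof. by move=> x y; apply/asboolP/asboolP => /geq_sym. Qed.

Fact geqb_trans : transitive geqb.
Proof.
by move=> y x z /asboolP xy /asboolP yz; apply/asboolP; apply: geq_trans xy yz.
Qed.

Canonical geqb_equiv := EquivRel geqb geqb_refl geqb_sym geqb_trans.

Definition gis : Type := {eq_quot geqb}%qT.

HB.instance Definition _ := Choice.on gis.

Definition gclass (x : gterm) : gis := (\pi_({eq_quot geqb}) x)%qT.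

Definition gmul (x y : gis) : gis := gclass (TMul (repr x) (repr y)).

Lemma gclassP x y : gclass x = gclass y <-> geq x y.
Proof.
by split=> [/eqmodP/asboolP|h]; last by apply/eqmodP/asboolP.
Qed.

Lemma geq_repr x : geq (repr (gclass x)) x.
Proof. by apply/gclassP; apply: reprK. Qed.

Lemma gmulE x y : gmul (gclass x) (gclass y) = gclass (TMul x y).
Proof. by apply/gclassP; apply: geq_mul; apply: geq_repr. Qed.

Fact gmulA : associative gmul.
Proof.
move=> x y z; rewrite -[x]reprK -[y]reprK -[z]reprK -!/(gclass _) !gmulE.
by apply/gclassP; apply: geq_assoc.
Qed.

HB.instance Definition _ := isSemigroup.Build gis gmulA.

Definition gzero : gis := gclass TZero.
Definition gvert (v : vertex E) : gis := gclass (TVert v).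
Definition gedge (e : edge E) : gis := gclass (TEdge e).
Definition ginv (e : edge E) : gis := gclass (TInv e).

End GraphInverseSemigroup.

(* For acyclic graphs only: the third component of a Wang triple is a function
   on the set of cycles, so it is empty and omitted here. *)
Record wang_triple (E : digraph) := WangTriple {
  wangH : {set vertex E};
  wangW : {set vertex E};
  wangH_hereditary : hereditary wangH;
  wangW_sub :
    wangW \subset
      [set v | (v \notin wangH) && (#|out_edges_off wangH v| == 1)]%SET
}.

Section Wang.
Variable E : digraph.
Implicit Type T : wang_triple E.

Definition wang_rel T : set (gis E * gis E) :=
  [set p | exists2 v, v \in wangH T & p = (gvert v, gzero E)] `|`
  [set p | exists w e, [/\ w \in wangW T, src e = w, rng e \notin wangH T &
                           p = (gvert w, (gedge e * ginv e)%g)]].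

Definition wang_congruence T : congruence (gis E) := cong_gen (wang_rel T).

Definition sink_triple T : Prop :=
  exists v : vertex E,
    [/\ #|out_edges v| = 0, wangH T = [set v]%SET & wangW T = finset.set0].

Definition minimal_out1 (v : vertex E) (H : {set vertex E}) : Prop :=
  [/\ hereditary H, #|out_edges_off H v| = 1 &
      forall K : {set vertex E}, hereditary K -> #|out_edges_off K v| = 1 ->
        K \subset H -> K = H].

Definition vertex_triple T : Prop :=
  exists v : vertex E,
    [/\ 0 < #|out_edges v|, minimal_out1 v (wangH T) &
        wangW T = [set v]%SET].

End Wang.

(* Main.v *)
Require Import Defs.
From mathcomp Require Import all_boot all_order.
From mathcomp Require Import boolp classical_sets.

(** In a finite lattice the sets that generate under finite joins are those that
    contain every join-irreducible element, so the theorem says that the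
    congruences of types (i) and (ii) are exactly the join-irreducible ones.
    Both halves go through the Wang triple $(H_c, W_c)$ of a congruence $c$:
    $H_c$ collects the vertices identified with zero, and $W_c$ those with a
    unique edge $e$ off $H_c$ that $c$ identifies with $e e^{-1}$.

    Upper bound: [le_of_triple] shows that a congruence containing the generators
    attached to $(H_c, W_c)$ contains $c$. Every nonzero element has the form
    $p q^{-1}$; multiplying an identity $p q^{-1} \equiv r s^{-1}$ by $p^{-1}$ and
    $q$ reduces it, since there are no closed paths, to $v \equiv r' s'^{-1}$,
    and conjugating by the edges out of $v$ peels $r'$ and $s'$ off simultaneously
    ([loop_cong]).

    Lower bound: $G(E)$ acts by partial injections on the paths of $E \setminus H$
    that do not end in $W$. The kernel of this action contains the congruence of
    $(H, W)$ but identifies no further vertex with zero or with some $e e^{-1}$.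
    Hence an inclusion of congruences forces the order relation between their
    triples ([wang_congruence_le_triple]).

    Types (i) and (ii) are irreducible because everything strictly below
    $(\{v\}, \varnothing)$ is trivial, and everything strictly below
    $(H, \{v\})$ is below $(H, \varnothing)$ by minimality of $H$. Conversely a
    congruence $c$ is the join of those of types (i) and (ii) below it
    ([le_of_generators]). For $w \in W_c$, shrink $H_c$ to a minimal $H$ for $w$:
    the unique edge does not change. A vertex $v \in H_c$ is treated by induction
    from the sinks upwards: for a suitable minimal $H \subseteq H_c$
    ([hereditary_out1_exists]), type (ii) gives $v \equiv e e^{-1}$, and
    $r(e) \equiv 0$ is already known. *)

Set Implicit Arguments.
Unset Strict Implicit.
Unset Printing Implicit Defensive.

(** * Paths, reachability and hereditary sets *)

Section Graph.
Variable E : digraph.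
Implicit Types (u v w : vertex E) (e f : edge E) (p q : seq (edge E)).
Implicit Types (H K : {set vertex E}).

Lemma is_path_cat u p q v :
  is_path u (p ++ q) v <-> exists2 w, is_path u p w & is_path w q v.
Proof.
elim: p u => [|e p IH] u /=.
  by split=> [h|[w /eqP ->]//]; exists u.
split=> [/andP[-> /IH]//|[w /andP[-> hp] hq]].
by apply/IH; exists w.
Qed.

Lemma is_path_fun u p v w : is_path u p v -> is_path u p w -> v = w.
Proof.
elim: p u => [|e p IH] u /=; first by move=> /eqP <- /eqP.
by case/andP=> _ hv /andP[_ hw]; apply: IH hv hw.
Qed.

Lemma reaches_refl u : reaches u u.
Proof. by exists [::] => /=. Qed.

Lemma reaches_trans v u w : reaches u v -> reaches v w -> reaches u w.
Proof.
by move=> [p hp] [q hq]; exists (p ++ q); apply/is_path_cat; exists v.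
Qed.

Lemma reaches_edge e : reaches (src e) (rng e).
Proof. by exists [:: e]; rewrite /= !eqxx. Qed.

Lemma hereditary_rng H e : hereditary H -> src e \in H -> rng e \in H.
Proof. by move=> hH /hH; apply; apply: reaches_edge. Qed.

Lemma edges_hereditary H :
  (forall e, src e \in H -> rng e \in H) -> hereditary H.
Proof.
move=> hH u v uH [p]; elim: p u uH => [|e p IH] u uH /=; first by move/eqP<-.
by case/andP=> /eqP eu; apply: IH; apply: hH; rewrite eu.
Qed.

Lemma out_edges_off1 H v e :
  src e = v -> v \notin H -> rng e \notin H ->
  (forall f, src f = v -> rng f \notin H -> f = e) ->
  #|out_edges_off H v| = 1.
Proof.
move=> ev vH eH uniq_e; apply/eqP/cards1P; exists e; apply/setP => f.
rewrite !inE; apply/idP/eqP => [/andP[/andP[_ fH] /eqP fv]|->].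
  exact: uniq_e.
by rewrite ev eqxx vH eH.
Qed.

Lemma out_edges_off1_exists H v :
  #|out_edges_off H v| = 1 ->
  exists e, [/\ src e = v, v \notin H, rng e \notin H &
                forall f, src f = v -> rng f \notin H -> f = e].
Proof.
move/eqP/cards1P => [e he].
have : e \in out_edges_off H v by rewrite he set11.
rewrite !inE => /andP[/andP[sH rH] /eqP ev]; exists e.
split=> //; first by rewrite -ev.
move=> f fv fH; apply/set1P; rewrite -he !inE fv fH eqxx /=.
by rewrite -ev sH.
Qed.

(** Shrinking [H] only adds edges to [E \ H], so a vertex with exactly one
    outgoing edge off both sets has the same one. *)
Lemma out_edges_off1_sub H K v e : H \subset K ->
  #|out_edges_off H v| = 1 -> #|out_edges_off K v| = 1 ->
  src e = v -> rng e \notin H -> rng e \notin K.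
Proof.
move=> HK /out_edges_off1_exists[f [_ _ _ uf]].
move=> /out_edges_off1_exists[g [gv _ gK _]] ev eH.
have gH : rng g \notin H by apply: contra gK; apply: (fintype.subsetP HK).
by rewrite (uf _ ev eH) -(uf _ gv gH).
Qed.

Lemma minimal_out1_exists K v :
  hereditary K -> #|out_edges_off K v| = 1 ->
  exists2 H, minimal_out1 v H & H \subset K.
Proof.
move=> hK oK.
pose P H := `[< hereditary H >] && (#|out_edges_off H v| == 1).
have PK : P K by rewrite /P oK eqxx andbT; apply/asboolP.
have [H /minsetP[/andP[/asboolP hH /eqP oH] mH] HK] := minset_exists PK.
exists H => //; split=> // L hL oL LH; apply: mH => //.
by rewrite /P oL eqxx andbT; apply/asboolP.
Qed.

Lemma repeated_source p : ~~ uniq (map (@src E) p) ->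
  exists p1 e p2 f p3, p = p1 ++ e :: p2 ++ f :: p3 /\ src e = src f.
Proof.
elim: p => //= e p IH; rewrite negb_and negbK => /orP[/mapP[f fp ef]|].
  by case/splitPr: fp => p2 p3; exists [::], e, p2, f, p3.
move=> /IH[p1 [e' [p2 [f [p3 [-> ef]]]]]].
by exists (e :: p1), e', p2, f, p3.
Qed.

Section Simple.
Hypothesis hE : simple_digraph E.

(** A cycle has distinct sources, but a closed path with a repeated source
    contains a shorter closed path, so acyclicity excludes all of them. *)
Lemma closed_path_nil u p : is_path u p u -> p = [::].
Proof.
have [n] := ubnP (size p); elim: n u p => // n IH u p ltp hp.
apply/eqP/negPn/negP => p0.
case: (boolP (uniq (map (@src E) p))) => [up|].
  by case: (hE.1 p); split=> //; exists u.
move=> /repeated_source[p1 [e [p2 [f [p3 [def_p ef]]]]]].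
have hep : is_path (src e) (e :: p2) (src e).
  move: hp; rewrite def_p => /is_path_cat[w _].
  rewrite -cat_cons => /is_path_cat[x /= /andP[_ hx] /andP[/eqP fx _]].
  by rewrite eqxx /= ef fx.
suff : e :: p2 = [::] by [].
apply: IH hep; apply: (leq_trans _ (ltnSE ltp)).
rewrite def_p size_cat /= size_cat /=; apply: (leq_trans _ (leq_addl _ _)).
by rewrite addnS !ltnS leq_addr.
Qed.

Lemma rng_not_reaches_src e : ~ reaches (rng e) (src e).
Proof.
move=> [p hp]; suff : e :: p = [::] by [].
by apply: (@closed_path_nil (src e)); rewrite /= eqxx.
Qed.

Let rank u := #|[set x | `[< reaches u x >]]%SET|.

Lemma rank_rng e : rank (rng e) < rank (src e).
Proof.
apply: proper_card; apply/properP; split.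
  apply/fintype.subsetP => x; rewrite !finset.in_set => /asboolP h; apply/asboolP.
  exact: reaches_trans (reaches_edge e) h.
exists (src e); rewrite finset.in_set; first exact/asboolP/reaches_refl.
by apply/asboolP/rng_not_reaches_src.
Qed.

Lemma rank_reaches u v : reaches u v -> rank v <= rank u.
Proof.
move=> huv; apply/subset_leq_card/fintype.subsetP => x.
by rewrite !finset.in_set => /asboolP h; apply/asboolP; apply: reaches_trans huv h.
Qed.

Lemma rng_ind (P : vertex E -> Prop) :
  (forall u, (forall e, src e = u -> P (rng e)) -> P u) -> forall u, P u.
Proof.
move=> step u; have [n] := ubnP (rank u); elim: n u => // n IH u ltu.
by apply: step => e eu; apply: IH; apply: (leq_trans _ (ltnSE ltu)); rewrite -eu rank_rng.
Qed.

(** Keep one edge [e] out of [v] whose range is as high as possible, and take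
    everything below the ranges of the other edges: maximality, acyclicity and
    the absence of parallel edges keep the range of [e] outside. *)
Lemma hereditary_out1_exists v : 0 < #|out_edges v| ->
  exists K, [/\ hereditary K, #|out_edges_off K v| = 1 &
    forall H, hereditary H -> v \in H -> K \subset H].
Proof.
move=> /card_gt0P[e0 he0].
have [e eout emax] := arg_maxnP (fun f => rank (rng f)) he0.
have ev : src e = v.
  have : e \in out_edges v by [].
  by rewrite finset.in_set => /eqP.
pose K := [set x | `[< exists f, [/\ src f = v, f <> e & reaches (rng f) x] >]]%SET.
have rngK f : src f = v -> f <> e -> rng f \in K.
  move=> fv fe; rewrite finset.in_set; apply/asboolP; exists f; split=> //.
  exact: reaches_refl.
exists K; split.
- move=> x y; rewrite !finset.in_set => /asboolP[f [fv fe fx]] xy; apply/asboolP.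
  by exists f; split=> //; apply: reaches_trans fx xy.
- apply: (out_edges_off1 ev).
  + rewrite finset.in_set; apply/asboolP => -[f [fv _]]; rewrite -fv.
    exact: rng_not_reaches_src.
  + rewrite finset.in_set; apply/asboolP => -[f [fv fe [p]]].
    case: p => [/eqP efr|g p /= /andP[/eqP gf hp]].
      by apply: fe; apply: hE.2 => //; rewrite fv.
    have fout : f \in out_edges v by rewrite finset.in_set fv.
    have := emax f fout; rewrite /= -gf; apply/negP; rewrite -ltnNge.
    by apply: leq_ltn_trans (rank_rng g); apply: rank_reaches; exists p.
  + move=> f fv fK; apply: contrapT => fe.
    by move: fK; rewrite rngK.
- move=> H hH vH; apply/fintype.subsetP => x; rewrite finset.in_set.
  move=> /asboolP[f [fv _ fx]]; apply: (hH _ _ _ fx).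
  by apply: (hereditary_rng hH); rewrite fv.
Qed.

End Simple.
End Graph.

(** * Normal forms in the graph inverse semigroup *)

Section CongruenceTheory.
Variables (S : semigroupType) (c : congruence S).

Lemma cong_refl x : cong_rel c (x, x).
Proof. by have [h _ _ _] := congruenceP c; apply: h. Qed.

Lemma cong_sym x y : cong_rel c (x, y) -> cong_rel c (y, x).
Proof. by have [_ h _ _] := congruenceP c; apply: h. Qed.

Lemma cong_trans y x z : cong_rel c (x, y) -> cong_rel c (y, z) -> cong_rel c (x, z).
Proof. by have [_ _ h _] := congruenceP c; apply: h. Qed.

Lemma cong_mull z x y : cong_rel c (x, y) -> cong_rel c (z * x, z * y)%g.
Proof. by have [_ _ _ h] := congruenceP c; case/(h _ _ z). Qed.

Lemma cong_mulr z x y : cong_rel c (x, y) -> cong_rel c (x * z, y * z)%g.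
Proof. by have [_ _ _ h] := congruenceP c; case/(h _ _ z). Qed.

End CongruenceTheory.

Lemma cong_gen_le (S : semigroupType) (r : set (S * S)) (b : congruence S) :
  (forall x, r x -> cong_rel b x) -> (cong_gen r <= b)%O.
Proof.
by move=> h; apply/le_congP; apply: smallest_sub => //; apply: congruenceP.
Qed.

Section NormalForm.
Variable E : digraph.
Implicit Types (u v w : vertex E) (e f : edge E) (p q r s : seq (edge E)).
Local Notation G := (gis E).
Local Notation gz := (gzero E).
Local Open Scope group_scope.

Lemma gclassM (x y : gterm E) : (gclass x : G) * gclass y = gclass (TMul x y).
Proof. exact: gmulE. Qed.

Lemma mul0G (x : G) : gz * x = gz.
Proof.
by rewrite -[x]reprK -/(gclass _) gclassM; apply/gclassP/geq_mul0t.
Qed.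

Lemma mulG0 (x : G) : x * gz = gz.
Proof.
by rewrite -[x]reprK -/(gclass _) gclassM; apply/gclassP/geq_mult0.
Qed.

Lemma gvertM u v : gvert u * gvert v = if u == v then gvert u else gz.
Proof.
rewrite gclassM; have /gclassP -> := geq_vert v u.
by case: ifP.
Qed.

Lemma gvertK u : gvert u * gvert u = gvert u.
Proof. by rewrite gvertM eqxx. Qed.

Lemma src_gedge e : gvert (src e) * gedge e = gedge e.
Proof. by rewrite gclassM; apply/gclassP/geq_src_edge. Qed.

Lemma gedge_rng e : gedge e * gvert (rng e) = gedge e.
Proof. by rewrite gclassM; apply/gclassP/geq_edge_rng. Qed.

Lemma rng_ginv e : gvert (rng e) * ginv e = ginv e.
Proof. by rewrite gclassM; apply/gclassP/geq_rng_inv. Qed.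

Lemma ginv_src e : ginv e * gvert (src e) = ginv e.
Proof. by rewrite gclassM; apply/gclassP/geq_inv_src. Qed.

Lemma ginv_gedge e : ginv e * gedge e = gvert (rng e).
Proof.
by rewrite gclassM; have /gclassP -> := geq_inv_edge e e; rewrite eqxx.
Qed.

Lemma ginv_gedge_neq e f : e <> f -> ginv e * gedge f = gz.
Proof.
move=> /eqP/negbTE ef.
by rewrite gclassM; have /gclassP -> := geq_inv_edge e f; rewrite ef.
Qed.

(** The base vertex is an argument because an empty sequence of edges does not
    determine the vertex it stands for. *)
Fixpoint gpath u p : G :=
  if p is e :: p' then gedge e * gpath (rng e) p' else gvert u.

Fixpoint gpathV u p : G :=
  if p is e :: p' then gpathV (rng e) p' * ginv e else gvert u.

Lemma gvert_gpath u p w : is_path u p w -> gvert u * gpath u p = gpath u p.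
Proof.
case: p => [|e p] /=; first by rewrite gvertK.
by case/andP=> /eqP <- _; rewrite mulgA src_gedge.
Qed.

Lemma gpathV_gvert u p w : is_path u p w -> gpathV u p * gvert u = gpathV u p.
Proof.
case: p => [|e p] /=; first by rewrite gvertK.
by case/andP=> /eqP <- _; rewrite -mulgA ginv_src.
Qed.

Lemma gpath_cat u p w q v : is_path u p w -> is_path w q v ->
  gpath u (p ++ q) = gpath u p * gpath w q.
Proof.
elim: p u => [|e p IH] u /=; first by move=> /eqP -> /gvert_gpath ->.
by case/andP=> _ hp hq; rewrite -mulgA (IH (rng e)).
Qed.

Lemma gpathV_cat u p w q v : is_path u p w -> is_path w q v ->
  gpathV u (p ++ q) = gpathV w q * gpathV u p.
Proof.
elim: p u => [|e p IH] u /=; first by move=> /eqP -> /gpathV_gvert ->.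
by case/andP=> _ hp hq; rewrite mulgA (IH (rng e)).
Qed.

Lemma gpath_gvert u p w : is_path u p w -> gpath u p * gvert w = gpath u p.
Proof.
by move=> hp; rewrite -(@gpath_cat u p w [::] w) ?cats0 //=.
Qed.

Lemma gvert_gpathV u p w : is_path u p w -> gvert w * gpathV u p = gpathV u p.
Proof.
by move=> hp; rewrite -(@gpathV_cat u p w [::] w) ?cats0 //=.
Qed.

Lemma gpathVK u p w : is_path u p w -> gpathV u p * gpath u p = gvert w.
Proof.
elim: p u => [|e p IH] u /=; first by move/eqP->; rewrite gvertK.
case/andP=> _ hp.
by rewrite mulgA -(mulgA _ (ginv e)) ginv_gedge (gpathV_gvert hp) IH.
Qed.

(** Equal first edges cancel, and the first pair of distinct ones gives zero. *)
Lemma gpathV_gpath u p w v q w' : is_path u p w -> is_path v q w' ->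
  [\/ gpathV u p * gpath v q = gz,
      u = v /\ (exists r, q = p ++ r) |
      u = v /\ (exists r, p = q ++ r)].
Proof.
move=> hp hq; case: (u =P v) => [uv|uv]; [subst v|]; last first.
  apply: Or31; rewrite -(gpathV_gvert hp) -(gvert_gpath hq) -mulgA.
  by rewrite (mulgA (gvert u)) gvertM; move/eqP/negbTE: uv => ->;
     rewrite mul0G mulG0.
suff [->|[r ->]|[r ->]] : [\/ gpathV u p * gpath u q = gz,
    exists r, q = p ++ r | exists r, p = q ++ r].
- exact: Or31.
- by apply: Or32; split=> //; exists r.
- by apply: Or33; split=> //; exists r.
elim: p u q hp hq => [|e p IH] u q; first by move=> _ _; apply: Or32; exists q.
case: q => [|f q] /=; first by move=> _ _; apply: Or33; exists (e :: p).
case/andP=> _ hp /andP[_ hq].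
case: (e =P f) => [ef|ef]; [subst f|]; last first.
  by apply: Or31; rewrite mulgA -(mulgA _ (ginv e)) ginv_gedge_neq // mulG0 mul0G.
rewrite mulgA -(mulgA _ (ginv e)) ginv_gedge (gpathV_gvert hp).
case: (IH _ _ hp hq) => [->|[r ->]|[r ->]]; first exact: Or31.
  by apply: Or32; exists r.
by apply: Or33; exists r.
Qed.

Definition normal u p v q w (x : G) :=
  [/\ is_path u p w, is_path v q w & x = gpath u p * gpathV v q].

Lemma normal_form (x : G) : x = gz \/ exists u p v q w, normal u p v q w x.
Proof.
have -> : x = gclass (repr x) by rewrite -[LHS]reprK.
elim: (repr x) => {x} [|v|e|e|x IHx y IHy].
- by left.
- by right; exists v, [::], v, [::], v; split=> //=; rewrite gvertK.
- right; exists (src e), [:: e], (rng e), [::], (rng e).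
  by split; rewrite ?/= ?eqxx // -mulgA gvertK gedge_rng.
- right; exists (rng e), [::], (src e), [:: e], (rng e).
  by split; rewrite ?/= ?eqxx // mulgA gvertK rng_ginv.
rewrite -gclassM.
case: IHx => [->|[u [p [v [q [w [hp hq ->]]]]]]]; first by left; rewrite mul0G.
case: IHy => [->|[u' [r [v' [s [w' [hr hs ->]]]]]]]; first by left; rewrite mulG0.
rewrite mulgA -(mulgA (gpath u p)).
case: (gpathV_gpath hq hr) => [->|[eu [t et]]|[eu [t et]]].
- by left; rewrite mulG0 mul0G.
- subst u' r; right; have /is_path_cat[z hz ht] := hr.
  have ez : gpathV v q * gpath v q = gvert w by apply: gpathVK.
  rewrite (is_path_fun hz hq) in ht.
  rewrite (gpath_cat hq ht) (mulgA (gpathV v q)) ez (gvert_gpath ht) -(gpath_cat hp ht).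
  by exists u, (p ++ t), v', s, w'; split=> //; apply/is_path_cat; exists w.
- subst u' q; right; have /is_path_cat[z hz ht] := hq.
  rewrite (is_path_fun hz hr) in ht.
  rewrite (gpathV_cat hr ht) -(mulgA (gpathV w' t)) (gpathVK hr).
  rewrite (gpathV_gvert ht) -mulgA -(gpathV_cat hs ht).
  by exists u, p, v', (s ++ t), w; split=> //; apply/is_path_cat; exists w'.
Qed.

End NormalForm.

(** * Congruences are determined by their Wang triples *)

Section Triple.
Variable E : digraph.
Implicit Types (u v w : vertex E) (e f : edge E) (p q r s : seq (edge E)).
Implicit Types (b c : congruence (gis E)).
Local Notation gz := (gzero E).
Local Open Scope group_scope.

Definition zero_set c : {set vertex E} :=
  [set v | `[< cong_rel c (gvert v, gz) >]]%SET.

Lemma in_zero_set c v : v \in zero_set c <-> cong_rel c (gvert v, gz).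
Proof. by rewrite finset.in_set; split=> /asboolP. Qed.

(** At most one edge satisfies the conditions on [e], so the quantifier does not
    strengthen the requirement of a Wang triple. *)
Definition fold_set c : {set vertex E} :=
  [set v | [&& v \notin zero_set c, #|out_edges_off (zero_set c) v| == 1%N &
     `[< forall e, src e = v -> rng e \notin zero_set c ->
           cong_rel c (gvert v, gedge e * ginv e) >]]]%SET.

Lemma cong_zero_mul c (x y z : gis E) :
  cong_rel c (y, gz) -> cong_rel c (x * y * z, gz).
Proof.
by move=> h; have := cong_mulr z (cong_mull x h); rewrite mulG0 mul0G.
Qed.

Lemma cong_zero_edge c e :
  cong_rel c (gvert (rng e), gz) -> cong_rel c (gedge e * ginv e, gz).
Proof. by move/(cong_zero_mul (gedge e) (ginv e)); rewrite gedge_rng. Qed.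

Lemma zero_set_hereditary c : hereditary (zero_set c).
Proof.
apply: edges_hereditary => e /in_zero_set h; apply/in_zero_set.
by have := cong_zero_mul (ginv e) (gedge e) h; rewrite ginv_src ginv_gedge.
Qed.

Fact fold_set_sub c : fold_set c \subset
  [set v | (v \notin zero_set c) && (#|out_edges_off (zero_set c) v| == 1%N)]%SET.
Proof.
apply/fintype.subsetP => v; rewrite !finset.in_set.
by case/and3P => -> ->.
Qed.

Definition triple_of c : wang_triple E :=
  WangTriple (@zero_set_hereditary c) (fold_set_sub c).

Lemma wang_congruence_le T b :
  (forall v, v \in wangH T -> cong_rel b (gvert v, gz)) ->
  (forall e, src e \in wangW T -> rng e \notin wangH T ->
     cong_rel b (gvert (src e), gedge e * ginv e)) ->
  (wang_congruence T <= b)%O.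
Proof.
move=> hH hW; apply: cong_gen_le => x [[v vH ->]|[w [e [wW ew eH ->]]]].
  exact: hH.
by rewrite -ew; apply: hW => //; rewrite ew.
Qed.

Lemma wang_congruence_zero T v :
  v \in wangH T -> cong_rel (wang_congruence T) (gvert v, gz).
Proof. by move=> vH; apply: sub_gen_smallest; left; exists v. Qed.

Lemma wang_congruence_fold T e : src e \in wangW T -> rng e \notin wangH T ->
  cong_rel (wang_congruence T) (gvert (src e), gedge e * ginv e).
Proof.
by move=> eW eH; apply: sub_gen_smallest; right; exists (src e), e.
Qed.

Lemma wang_out1 T v : v \in wangW T ->
  v \notin wangH T /\ #|out_edges_off (wangH T) v| = 1%N.
Proof.
move/(fintype.subsetP (wangW_sub T)); rewrite finset.in_set.
by case/andP=> ? /eqP.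
Qed.

Lemma fold_set_cong c e : src e \in fold_set c -> rng e \notin zero_set c ->
  cong_rel c (gvert (src e), gedge e * ginv e).
Proof.
by rewrite finset.in_set => /and3P[_ _ /asboolP h]; apply: h.
Qed.

Lemma triple_of_le c : (wang_congruence (triple_of c) <= c)%O.
Proof.
apply: wang_congruence_le => [v /in_zero_set //|e eW eH].
exact: fold_set_cong.
Qed.

Hypothesis hE : simple_digraph E.

Section Generators.
Variables b c : congruence (gis E).
Hypothesis zero_b : forall v, v \in zero_set c -> cong_rel b (gvert v, gz).
Hypothesis fold_b : forall e, src e \in fold_set c -> rng e \notin zero_set c ->
  cong_rel b (gvert (src e), gedge e * ginv e).

(** If [c] identifies $u$ with $p q^{-1}$, then conjugating by the edges out of
    [u] shows that [p] and [q] start with the same edge $e$, that every other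
    edge out of [u] leads into the zero set, and that $r(e)$ is again
    identified with the remainder of $p q^{-1}$. *)
Lemma loop_cong u p q w :
  is_path u p w -> is_path u q w -> w \notin zero_set c ->
  cong_rel c (gvert u, gpath u p * gpathV u q) ->
  cong_rel b (gvert u, gpath u p * gpathV u q).
Proof.
move=> + + wH; elim: p u q => [|e p IH] u q.
  move=> /= /eqP uw; rewrite -uw => hq _.
  by rewrite (closed_path_nil hE hq) /= gvertK; apply: cong_refl.
case: q => [|f q] hp hq.
  by have /= /eqP uw := hq; rewrite -uw in hp; have := closed_path_nil hE hp.
move: hp hq => /= /andP[/eqP eu hp] /andP[/eqP fu hq] huc.
have outside g x : is_path (rng g) x w -> rng g \notin zero_set c.
  by move=> hx; apply: contra wH => /zero_set_hereditary; apply; exists x.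
have eH := outside _ _ hp.
set P := gpath (rng e) p in huc *; set Q := gpathV (rng f) q in huc *.
have conj g : src g = u ->
  cong_rel c (gvert (rng g), (ginv g * gedge e) * (P * Q) * (ginv f * gedge g)).
  move=> gu; have := cong_mulr (gedge g) (cong_mull (ginv g) huc).
  by rewrite -[X in gvert X]gu ginv_src ginv_gedge !mulgA.
have ef : e = f.
  apply: contrapT => ef; move/negP: eH; apply; apply/in_zero_set.
  by have := conj _ eu; rewrite (@ginv_gedge_neq _ f e) ?mulG0 // => /esym.
subst f.
have he : cong_rel c (gvert (rng e), P * Q).
  have := conj _ eu; rewrite ginv_gedge mulgA (gvert_gpath hp) -mulgA.
  by rewrite (gpathV_gvert hq).
have eeE : gedge e * gvert (rng e) * ginv e = gedge e * ginv e.
  by rewrite gedge_rng.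
have peel d : cong_rel d (gvert (rng e), P * Q) ->
  cong_rel d (gedge e * ginv e, gedge e * P * (Q * ginv e)).
  move=> h; have := cong_mulr (ginv e) (cong_mull (gedge e) h).
  by rewrite eeE !mulgA.
have uW : u \in fold_set c.
  have uH : u \notin zero_set c.
    by apply: contra eH; rewrite -eu; apply/hereditary_rng/zero_set_hereditary.
  have uniq_e g : src g = u -> rng g \notin zero_set c -> g = e.
    move=> gu; apply: contraNP => ge; apply/in_zero_set.
    by have := conj _ gu; rewrite ginv_gedge_neq // !mul0G.
  rewrite finset.in_set uH (out_edges_off1 eu uH eH uniq_e); apply/asboolP.
  move=> g gu gH; rewrite (uniq_e g gu gH).
  exact: cong_trans huc (cong_sym (peel _ he)).
(* [u] is identified with its range projection, which expands along the
   identity already known at the range of [e]. *)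
apply: (@cong_trans _ _ (gedge e * ginv e)).
  by rewrite -{1}eu; apply: fold_b => //; rewrite eu.
exact/peel/IH.
Qed.

(** Cancelling the common prefixes reduces the identity to one at the vertex [w],
    where [loop_cong] applies. *)
Lemma nested_cong u p v q w r s w' :
  is_path u p w -> is_path v q w -> is_path w r w' -> is_path w s w' ->
  w' \notin zero_set c ->
  cong_rel c (gpath u p * gpathV v q, gpath u (p ++ r) * gpathV v (q ++ s)) ->
  cong_rel b (gpath u p * gpathV v q, gpath u (p ++ r) * gpathV v (q ++ s)).
Proof.
move=> hp hq hr hs wH; rewrite (gpath_cat hp hr) (gpathV_cat hq hs).
move/(cong_mull (gpathV u p))/(cong_mulr (gpath v q)).
rewrite !mulgA (gpathVK hp) (gvert_gpathV hq) (gpathVK hq) (gvert_gpath hr).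
rewrite -(mulgA (_ * _)) (gpathVK hq) -(mulgA (gpath w r)) (gpathV_gvert hs).
move/(loop_cong hr hs wH) => h.
have := cong_mulr (gpathV v q) (cong_mull (gpath u p) h).
by rewrite (gpath_gvert hp) !mulgA.
Qed.

Lemma normal_zero u p v q w x :
  normal u p v q w x -> cong_rel c (x, gz) -> w \in zero_set c.
Proof.
move=> [hp hq ->] /(cong_zero_mul (gpathV u p) (gpath v q)) h.
apply/in_zero_set; move: h.
by rewrite mulgA (gpathVK hp) (gvert_gpathV hq) (gpathVK hq).
Qed.

Lemma zero_normal u p v q w x :
  normal u p v q w x -> w \in zero_set c -> cong_rel b (x, gz).
Proof.
move=> [hp hq ->] /zero_b/(cong_zero_mul (gpath u p) (gpathV v q)).
by rewrite (gpath_gvert hp).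
Qed.

Lemma zero_cong x : cong_rel c (x, gz) -> cong_rel b (x, gz).
Proof.
case: (normal_form x) => [-> _|[u [p [v [q [w hx]]]]]]; first exact: cong_refl.
by move/(normal_zero hx)/(zero_normal hx).
Qed.

(** Conjugating $p q^{-1} \equiv r s^{-1}$ by [p] and [q] shows that [p], [r] and
    [q], [s] are comparable. Extensions in opposite directions would close up to
    a nonempty closed path, so one of the two elements is nested in the other. *)
Lemma le_of_triple : (c <= b)%O.
Proof.
apply/le_congP => -[x y] hxy.
have [xz|xz] := pselect (cong_rel c (x, gz)).
  apply: cong_trans (zero_cong xz) _; apply/cong_sym/zero_cong.
  exact: cong_trans (cong_sym hxy) xz.
have [yz|yz] := pselect (cong_rel c (y, gz)).
  by case: xz; apply: cong_trans hxy yz.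
case: (normal_form x) => [x0|[u [p [v [q [w hx]]]]]].
  by case: xz; rewrite x0; apply: cong_refl.
case: (normal_form y) => [y0|[u' [r [v' [s [w' hy]]]]]].
  by case: yz; rewrite y0; apply: cong_refl.
have wH : w \notin zero_set c.
  apply/negP => /in_zero_set /(cong_zero_mul (gpath u p) (gpathV v q)).
  by case: hx => hp _ ex; rewrite (gpath_gvert hp) -ex.
have wH' : w' \notin zero_set c.
  apply/negP => /in_zero_set /(cong_zero_mul (gpath u' r) (gpathV v' s)).
  by case: hy => hr _ ey; rewrite (gpath_gvert hr) -ey.
case: hx hy => hp hq ex [hr hs ey].
have conj : cong_rel c (gvert w,
    (gpathV u p * gpath u' r) * (gpathV v' s * gpath v q)).
  have := cong_mulr (gpath v q) (cong_mull (gpathV u p) hxy).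
  by rewrite ex ey !mulgA (gpathVK hp) (gvert_gpathV hq) (gpathVK hq).
have closed t t' : is_path w t w' -> is_path w' t' w -> t = [::] /\ t' = [::].
  move=> ht ht'; have : t ++ t' = [::].
    by apply: (closed_path_nil hE (u := w)); apply/is_path_cat; exists w'.
  by case: t {ht} => // -> .
have diag z : z = x -> cong_rel b (x, z) by move=> ->; apply: cong_refl.
case: (gpathV_gpath hp hr) => [h0|[eu [t et]]|[eu [t et]]].
- by case/negP: wH; apply/in_zero_set; move: conj; rewrite h0 mul0G.
- subst u' r; have /is_path_cat[z hz ht] := hr.
  rewrite (is_path_fun hz hp) in ht.
  case: (gpathV_gpath hs hq) => [h0|[ev [t' et']]|[ev [t' et']]].
  + by case/negP: wH; apply/in_zero_set; move: conj; rewrite h0 mulG0.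
  + subst v' q; have /is_path_cat[z' hz' ht'] := hq.
    rewrite (is_path_fun hz' hs) in ht'.
    have [t0 t0'] := closed _ _ ht ht'.
    by apply: diag; rewrite ex ey t0 t0' !cats0.
  + subst v' s; have /is_path_cat[z' hz' ht'] := hs.
    rewrite (is_path_fun hz' hq) in ht'.
    by rewrite ex ey; apply: (nested_cong hp hq ht ht' wH'); rewrite -ex -ey.
- subst u' p; have /is_path_cat[z hz ht] := hp.
  rewrite (is_path_fun hz hr) in ht.
  case: (gpathV_gpath hs hq) => [h0|[ev [t' et']]|[ev [t' et']]].
  + by case/negP: wH; apply/in_zero_set; move: conj; rewrite h0 mulG0.
  + subst v' q; have /is_path_cat[z' hz' ht'] := hq.
    rewrite (is_path_fun hz' hs) in ht'.
    rewrite ex ey; apply/cong_sym/(nested_cong hr hs ht ht' wH).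
    by rewrite -ex -ey; apply: cong_sym.
  + subst v' s; have /is_path_cat[z' hz' ht'] := hs.
    rewrite (is_path_fun hz' hq) in ht'.
    have [t0' t0] := closed _ _ ht' ht.
    by apply: diag; rewrite ex ey t0 t0' !cats0.
Qed.

End Generators.

Lemma triple_ofK c : wang_congruence (triple_of c) = c.
Proof.
apply/Order.POrderTheory.le_anti/andP; split; first exact: triple_of_le.
apply: le_of_triple => [v|e]; first exact: (@wang_congruence_zero (triple_of c)).
exact: (@wang_congruence_fold (triple_of c)).
Qed.

End Triple.

(** * A separating representation *)

Section Model.
Variable E : digraph.
Variable T : wang_triple E.
Implicit Types (u v w : vertex E) (e f : edge E) (p : seq (edge E)).
Implicit Types (s : vertex E * seq (edge E)) (x y : gterm E).
Local Notation gz := (gzero E).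
Local Notation H := (wangH T).
Local Notation W := (wangW T).

(** The vertices of [W] are folded into their unique outgoing edge, so the
    states are the paths of [E \ H] that do not stop at such a vertex. *)
Fixpoint state u p : bool :=
  if p is e :: p' then [&& src e == u, u \notin H & state (rng e) p']
  else (u \notin H) && (u \notin W).

Lemma state_notin u p : state u p -> u \notin H.
Proof. by case: p => [|e p] /= => [/andP[]|/and3P[]]. Qed.

Lemma state_src e p : state (rng e) p -> src e \notin H.
Proof.
move/state_notin; apply: contra; apply: hereditary_rng.
exact: wangH_hereditary.
Qed.

(** Left multiplication on paths. Every clause rejects arguments that are not
    states, so that no separate type of paths is needed. *)
Fixpoint act x s : option (vertex E * seq (edge E)) :=
  match x with
  | TZero => None
  | TVert v => if (s.1 == v) && state s.1 s.2 then Some s else None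
  | TEdge e => if (s.1 == rng e) && state s.1 s.2 then Some (src e, e :: s.2)
               else None
  | TInv e => if s.2 is f :: p then
                if (f == e) && state s.1 s.2 then Some (rng e, p) else None
              else None
  | TMul x y => obind (act x) (act y s)
  end.

Lemma geq_act x y : Defs.geq x y -> act x =1 act y.
Proof.
elim=> {x y} //=.
- by move=> x y _ h s.
- by move=> x y z _ h _ k s; rewrite h.
- by move=> x x' y y' _ h _ k s; rewrite k; case: (act y' s) => //=.
- by move=> x y z s; case: (act z s).
- by move=> x s; case: (act x s).
- move=> u v [a p] /=; case: (a =P u) => [->|au] /=; last first.
    by case: (v =P u) => [->|] //=; case: (a =P u).
  case: (boolP (state u p)) => [up|/negbTE up] /=.
    by rewrite eq_sym; case: (v =P u) => [->|] //=; rewrite eqxx up.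
  by case: (v =P u) => [->|] //=; rewrite up andbF.
- move=> e [a p] /=; case: ifP => //= /andP[/eqP -> up].
  by rewrite !eqxx (state_src up) /= ?up.
- move=> e [a p] /=; case: (a =P rng e) => [->|] //=.
  by case: ifP => //= up; rewrite eqxx up.
- move=> e [a [|f p]] //=; case: ifP => //= /andP[/eqP -> /and3P[_ _ up]].
  by rewrite eqxx up.
- move=> e [a [|f p]] /=; first by case: ifP.
  case: (f =P e) => [->|fe] /=; last by case: ifP => //= _; case: (f =P e).
  case: (a =P src e) => [->|ae] /=; last by case: (src e =P a) => // /esym.
  by case: ifP => //=; rewrite !eqxx /= => ->.
- move=> e f [a p] /=; case: (e =P f) => [<-|ef] /=; last first.
    by case: ifP => //= _; case: (f =P e) => // /esym.
  case: ifP => //= /andP[/eqP -> up].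
  by rewrite !eqxx (state_src up) /= ?up.
Qed.

Definition act_kernel : set (gis E * gis E) :=
  [set xy | act (repr xy.1) =1 act (repr xy.2)]%classic.

Lemma act_gclass x : act (repr (gclass x)) =1 act x.
Proof. exact/geq_act/geq_repr. Qed.

Lemma act_mul (x y : gis E) s :
  act (repr (x * y)%g) s = obind (act (repr x)) (act (repr y) s).
Proof. exact: act_gclass. Qed.

Lemma act_kernel_congruence : is_congruence act_kernel.
Proof.
split=> [x s //|x y h s|x y z h k s|x y z h].
- by rewrite /= h.
- by rewrite /= h k.
- split=> s; rewrite /= !act_mul; last by case: (act (repr z) s) => //=.
  by move: (h s) => /= ->.
Qed.

Definition act_congruence := mk_congruence act_kernel_congruence.

Lemma act_congruenceP x y :
  cong_rel act_congruence (gclass x, gclass y) <-> act x =1 act y.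
Proof.
split=> h s; first by rewrite -act_gclass -(act_gclass y); apply: h.
by rewrite /= !act_gclass.
Qed.

(** A state starting at a vertex [w] of [W] is nonempty, and its first edge is the
    unique edge $e$ off [H], so [w] and $e e^{-1}$ act alike. *)
Lemma wang_congruence_le_act : (wang_congruence T <= act_congruence)%O.
Proof.
apply: wang_congruence_le => [v vH|e eW eH].
  apply/act_congruenceP => -[u p] /=; case: ifP => // /andP[/eqP -> /state_notin].
  by rewrite vH.
rewrite gclassM; apply/act_congruenceP => -[u [|f p]] /=.
  by case: (u =P src e) => [->|] //=; rewrite eW andbF.
case: (f =P e) => [->|fe] /=.
  case: (src e =P u) => [<-|eu] /=; last by rewrite andbF.
  rewrite eqxx /=; case: ifP => //= /andP[_ up]; first by rewrite eqxx up.
case: (u =P src e) => [ue|] //=; case: ifP => // /and3P[/eqP fu _ /state_notin fH].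
have [_ /out_edges_off1_exists[g [_ _ _ ug]]] := wang_out1 eW.
by case: fe; rewrite (ug e) // (ug f) // fu.
Qed.

(** A vertex outside [H] acts nontrivially because some state starts there: follow
    the edges out of vertices of [W], which must stop since there are no cycles. *)
Lemma wang_zeroP v :
  simple_digraph E -> cong_rel (wang_congruence T) (gvert v, gz) -> v \in H.
Proof.
move=> hE /(le_congP _ _ wang_congruence_le_act)/act_congruenceP h.
have state_ex : forall u, u \notin H -> exists p, state u p.
  apply: (rng_ind hE) => u IH uH; case: (boolP (u \in W)) => uW; last first.
    by exists [::]; rewrite /= uH.
  have [_ /out_edges_off1_exists[e [eu _ eH _]]] := wang_out1 uW.
  by have [p hp] := IH e eu eH; exists (e :: p); rewrite /= eu eqxx uH.
apply/negPn/negP => /state_ex[p hp].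
by have := h (v, p); rewrite /= eqxx hp.
Qed.

(** Outside [W] the path of length 0 at the source of [e] is a state; the vertex
    fixes it, and $e e^{-1}$ does not. *)
Lemma wang_foldP e : src e \notin H ->
  cong_rel (wang_congruence T) (gvert (src e), (gedge e * ginv e)%g) ->
  src e \in W.
Proof.
move=> eH /(le_congP _ _ wang_congruence_le_act); rewrite gclassM.
move/act_congruenceP => /(_ (src e, [::])) /=; rewrite eqxx eH /=.
by case: (src e \in W).
Qed.

End Model.

(** The generators of the smaller congruence are tested in the action attached to
    the larger triple, which tells apart everything outside that triple. *)
Lemma wang_congruence_le_triple (E : digraph) (T1 T2 : wang_triple E) :
  simple_digraph E -> (wang_congruence T1 <= wang_congruence T2)%O ->
  wangH T1 \subset wangH T2 /\ wangW T1 :\: wangH T2 \subset wangW T2.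
Proof.
move=> hE /le_congP le12; split; apply/fintype.subsetP => v.
  by move=> /wang_congruence_zero/le12/(wang_zeroP hE).
rewrite finset.inE => /andP[vH vW].
have [_ /out_edges_off1_exists[e [ev _ eH _]]] := wang_out1 vW.
rewrite -ev in vH vW *.
by apply: (wang_foldP vH); apply: le12; apply: wang_congruence_fold.
Qed.

(** * Join-irreducible congruences *)

Section Generation.
Variable E : digraph.
Hypothesis hE : simple_digraph E.
Implicit Types (v w : vertex E) (e : edge E) (H : {set vertex E}).
Implicit Types (T : wang_triple E) (b c : congruence (gis E)).
Local Notation gz := (gzero E).

Lemma minimal_out1_triple v H : minimal_out1 v H ->
  exists T, [/\ wangH T = H & wangW T = [set v]%SET].
Proof.
move=> [hH oH _].
have sub : [set v]%SET \subset
    [set u | (u \notin H) && (#|out_edges_off H u| == 1)]%SET.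
  rewrite finset.sub1set finset.in_set oH eqxx andbT.
  by have [e [_ vH _ _]] := out_edges_off1_exists oH.
by exists (WangTriple hH sub).
Qed.

Lemma sink_triple_exists v : #|out_edges v| = 0 ->
  exists T, [/\ sink_triple T, wangH T = [set v]%SET & wangW T = finset.set0].
Proof.
move=> v0; have hH : hereditary [set v]%SET.
  apply: edges_hereditary => e; rewrite !finset.inE => /eqP ev.
  have /eqP := v0; rewrite cards_eq0 => /eqP v_sink.
  have : e \in out_edges v by rewrite finset.in_set ev.
  by rewrite v_sink finset.inE.
exists (WangTriple hH (finset.sub0set _)); split=> //.
by exists v.
Qed.

(** Passing from [K] to a minimal hereditary subset keeps the unique edge out of
    [v], so an identification $v \equiv e e^{-1}$ for the edge off [K] is enough
    to place a vertex triple at [v] below [c]. *)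
Lemma vertex_triple_below c K v :
  0 < #|out_edges v| -> hereditary K -> #|out_edges_off K v| = 1 ->
  K \subset zero_set c ->
  (forall e, src e = v -> rng e \notin K ->
     cong_rel c (gvert v, (gedge e * ginv e)%g)) ->
  exists T, [/\ vertex_triple T, (wang_congruence T <= c)%O,
                wangH T \subset K & wangW T = [set v]%SET].
Proof.
move=> v0 hK oK Kc cv; have [H mH HK] := minimal_out1_exists hK oK.
have [T [TH TW]] := minimal_out1_triple mH.
exists T; split; rewrite ?TH //; first by exists v; rewrite TH.
apply: wang_congruence_le => [u|e]; rewrite TH.
  by move/(fintype.subsetP HK)/(fintype.subsetP Kc)/in_zero_set.
rewrite TW => /finset.set1P ev eH; rewrite ev; apply: cv => //.
by case: mH => _ oH _; apply: (out_edges_off1_sub HK oH oK ev eH).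
Qed.

(** Vertices of the zero set of [c] are treated from the sinks upwards: if the
    vertex triple at [v] gives $v \equiv e e^{-1}$ and $r(e) \equiv 0$ is
    already known, then $v \equiv 0$. *)
Lemma le_of_generators b c :
  (forall T, sink_triple T -> (wang_congruence T <= c)%O ->
     (wang_congruence T <= b)%O) ->
  (forall T, vertex_triple T -> (wang_congruence T <= c)%O ->
     (wang_congruence T <= b)%O) ->
  (c <= b)%O.
Proof.
move=> sink_b vertex_b.
have vertex_cong T e : vertex_triple T -> (wang_congruence T <= c)%O ->
    wangW T = [set src e]%SET -> rng e \notin wangH T ->
    cong_rel b (gvert (src e), (gedge e * ginv e)%g).
  move=> vT Tc TW eH; apply: (le_congP _ _ (vertex_b T vT Tc)).
  by apply: wang_congruence_fold; rewrite // TW finset.set11.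
apply: (le_of_triple hE).
- apply: (rng_ind hE) => v IH vc; have cv0 := (in_zero_set c v).1 vc.
  have [v0|v0] := posnP #|out_edges v|.
    have [T [sT TH TW]] := sink_triple_exists v0.
    have Tc : (wang_congruence T <= c)%O.
      apply: wang_congruence_le => [u|e]; rewrite ?TH ?TW ?finset.inE //.
      by move/eqP->.
    apply: (le_congP _ _ (sink_b T sT Tc)).
    by apply: wang_congruence_zero; rewrite TH finset.set11.
  have [K [hK oK Ksub]] := hereditary_out1_exists hE v0.
  have Kc := Ksub _ (@zero_set_hereditary _ c) vc.
  have ee_c e : src e = v -> cong_rel c (gvert v, (gedge e * ginv e)%g).
    move=> ev; apply: (cong_trans cv0); apply/cong_sym/cong_zero_edge.
    apply/in_zero_set/hereditary_rng; first exact: zero_set_hereditary.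
    by rewrite ev.
  have [T [vT Tc TK TW]] :=
    vertex_triple_below v0 hK oK Kc (fun e ev _ => ee_c e ev).
  have [_ oT] : v \notin wangH T /\ #|out_edges_off (wangH T) v| = 1.
    by apply: wang_out1; rewrite TW finset.set11.
  have [e [ev _ eH _]] := out_edges_off1_exists oT.
  apply: (@cong_trans _ _ (gedge e * ginv e)%g).
    by rewrite -ev; apply: vertex_cong vT Tc _ eH; rewrite ev.
  apply/cong_zero_edge/IH => //.
  by apply/hereditary_rng; [exact: zero_set_hereditary | rewrite ev].
- move=> e ec eH; have [_ oc] := wang_out1 (T := triple_of c) ec.
  have v0 : 0 < #|out_edges (src e)|.
    by apply/card_gt0P; exists e; rewrite finset.in_set eqxx.
  have c_e f : src f = src e -> rng f \notin zero_set c ->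
      cong_rel c (gvert (src e), (gedge f * ginv f)%g).
    by move=> fe fH; rewrite -fe; apply: fold_set_cong; rewrite ?fe.
  have [T [vT Tc TH TW]] := vertex_triple_below v0
    (@zero_set_hereditary _ c) oc (fintype.subxx _) c_e.
  by apply: vertex_cong vT Tc TW _; apply: contra eH; apply/fintype.subsetP.
Qed.

(** If everything strictly below a Wang congruence lies below one $(K, \varnothing)$
    that does not contain it, the congruence cannot be a join of other ones. *)
Lemma wang_congruence_irreducible T K (s : seq (congruence (gis E))) :
  hereditary K -> (wangH T \subset K -> wangW T \subset K -> False) ->
  (forall T', wangH T' \subset wangH T -> wangW T' :\: wangH T \subset wangW T ->
     (wangH T' = wangH T /\ wangW T' = wangW T) \/
     (wangH T' \subset K /\ wangW T' \subset K)) ->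
  wang_congruence T = (\join_(x <- s) x)%O -> wang_congruence T \in s.
Proof.
move=> hK TK below Ts; apply: contrapT => Tns.
pose T0 := @WangTriple E K finset.set0 hK (finset.sub0set _).
have zero_K v : v \in K -> cong_rel (wang_congruence T0) (gvert v, gz).
  exact: (@wang_congruence_zero _ T0).
have leT0 c : c \in s -> (c <= wang_congruence T0)%O.
  move=> cs; have : (c <= wang_congruence T)%O.
    by rewrite Ts; apply: (Order.BJoinTheory.joins_sup_seq id).
  rewrite -{1}(triple_ofK hE c).
  move=> /(wang_congruence_le_triple hE)[Hc Wc].
  case: (below _ Hc Wc) => [[eH eW]|[HK WK]].
    case: Tns; move: cs; rewrite -(triple_ofK hE c).
    by rewrite /wang_congruence /wang_rel eH eW.
  rewrite -(triple_ofK hE c); apply: wang_congruence_le => [v|e].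
    by move/(fintype.subsetP HK)/zero_K.
  move=> /(fintype.subsetP WK) eK _; apply: cong_trans (zero_K _ eK) _.
  by apply: cong_sym; apply: cong_zero_edge; apply: zero_K; apply: (hereditary_rng hK).
have : (wang_congruence T <= wang_congruence T0)%O.
  by rewrite Ts big_seq; apply: Order.BJoinTheory.joins_le.
case/(wang_congruence_le_triple hE) => HK WK; apply: TK => //=.
by rewrite -finset.setD_eq0 -finset.subset0.
Qed.

(** A vertex without outgoing edges cannot belong to the second part of a triple,
    so only the bottom lies strictly below $(\{v\}, \varnothing)$. *)
Lemma sink_triple_irreducible T (s : seq (congruence (gis E))) :
  sink_triple T -> wang_congruence T = (\join_(x <- s) x)%O ->
  wang_congruence T \in s.
Proof.
move=> [v [v0 TH TW]]; apply: (@wang_congruence_irreducible _ finset.set0).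
- by apply: edges_hereditary => e; rewrite finset.inE.
- by rewrite TH finset.sub1set finset.inE.
move=> T'; rewrite TH TW => HT' WT'.
have W0 : wangW T' = finset.set0.
  apply/eqP; rewrite -finset.subset0; apply/fintype.subsetP => w wW.
  have [_ /out_edges_off1_exists[e [ew _ _ _]]] := wang_out1 wW.
  have wv : w = v.
    apply/finset.set1P; apply: contraT => wv.
    by have := fintype.subsetP WT' w; rewrite finset.in_setD wv wW finset.inE; apply.
  have : e \in out_edges v by rewrite finset.in_set ew wv.
  by move/eqP: v0; rewrite cards_eq0 => /eqP ->; rewrite finset.inE.
move: HT'; rewrite W0 finset.subset1 => /orP[/eqP ->|/eqP ->]; first by left.
by right; rewrite fintype.subxx.
Qed.

(** A triple below $(H, \{v\})$ whose second part still contains [v] has the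
    same hereditary part by minimality; all others lie below $(H, \varnothing)$. *)
Lemma vertex_triple_irreducible T (s : seq (congruence (gis E))) :
  vertex_triple T -> wang_congruence T = (\join_(x <- s) x)%O ->
  wang_congruence T \in s.
Proof.
move=> [v [_ [hH _ mH] TW]]; apply: (@wang_congruence_irreducible _ (wangH T)) => //.
  move=> _; rewrite TW finset.sub1set => vH.
  have [] : v \notin wangH T /\ #|out_edges_off (wangH T) v| = 1.
    by apply: wang_out1; rewrite TW finset.set11.
  by rewrite vH.
move=> T' HT' WT'; case: (boolP (v \in wangW T')) => vW; last first.
  right; split=> //; apply/fintype.subsetP => w wW; apply: contraT => wH.
  have := fintype.subsetP WT' w; rewrite finset.in_setD wH wW => /(_ isT).
  by rewrite TW => /finset.set1P wv; rewrite -wv wW in vW.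
left; have [_ oT'] := wang_out1 vW.
have eH : wangH T' = wangH T by apply: mH => //; apply: wangH_hereditary.
split=> //; apply/eqP; rewrite finset.eqEsubset {2}TW finset.sub1set vW andbT.
apply/fintype.subsetP => w wW; apply: (fintype.subsetP WT').
by rewrite finset.in_setD wW andbT -eH; have [] := wang_out1 wW.
Qed.

(** Wang triples carry proofs, so a finite list of Wang congruences is indexed
    by the underlying pairs of sets. *)
Lemma wang_congruences_finite (P : wang_triple E -> Prop) :
  exists s : seq (congruence (gis E)),
    (forall c, c \in s -> exists2 T, P T & c = wang_congruence T) /\
    (forall T, P T -> wang_congruence T \in s).
Proof.
pose pair T := (wangH T, wangW T).
pose of_pair (X : {set vertex E} * {set vertex E}) : congruence (gis E) :=
  if pselect (exists2 T, P T & pair T = X) is left h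
  then wang_congruence (projT1 (cid2 h)) else Order.bottom.
have pair_inj T T' : pair T = pair T' -> wang_congruence T = wang_congruence T'.
  by move=> [eH eW]; rewrite /wang_congruence /wang_rel eH eW.
exists [seq of_pair X | X <- enum [set X | `[< exists2 T, P T & pair T = X >]]%SET].
split=> [c /mapP[X]|T PT].
  rewrite mem_enum finset.in_set => /asboolP hX ->; rewrite /of_pair.
  case: pselect => // h; case: (cid2 h) => T PT _ /=.
  by exists T.
apply/mapP; exists (pair T).
  by rewrite mem_enum finset.in_set; apply/asboolP; exists T.
rewrite /of_pair; case: pselect => [h|[]]; last by exists T.
by case: (cid2 h) => T' _ /= eT; apply: pair_inj.
Qed.

End Generation.

Theorem theorem2p7 (E : digraph) (hE : simple_digraph E)
    (A : set (congruence (gis E))) :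
  join_generates A <->
  (forall T : wang_triple E, sink_triple T -> A (wang_congruence T)) /\
  (forall T : wang_triple E, vertex_triple T -> A (wang_congruence T)).
Proof.
split=> [gen|[A_sink A_vertex] c].
  by split=> T hT; have [s sA Ts] := gen (wang_congruence T); apply: sA;
    [apply: sink_triple_irreducible | apply: vertex_triple_irreducible].
have [s [sP sQ]] := wang_congruences_finite (fun T : wang_triple E =>
  (sink_triple T \/ vertex_triple T) /\ (wang_congruence T <= c)%O).
exists s => [x /sP[T [[hT|hT] _] ->]|]; [exact: A_sink|exact: A_vertex|].
have le_s T : (sink_triple T \/ vertex_triple T) ->
    (wang_congruence T <= c)%O -> (wang_congruence T <= \join_(x <- s) x)%O.
  move=> hT Tc; apply: (Order.BJoinTheory.joins_sup_seq id) => //.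
  exact: sQ.
apply/Order.POrderTheory.le_anti/andP; split.
  by apply: (le_of_generators hE) => T hT; apply: le_s; [left | right].
rewrite big_seq; apply: Order.BJoinTheory.joins_le => x /sP[T [_ Tc] ->].
exact: Tc.
Qed.
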